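(* Let $f,g:\mathbb{N}\to\mathbb{C}$ be arithmetic functions, not both identically zero, such that $f(n)=\sum_{d\mid n} g(d)$ for all $n\in\mathbb{N}$. If $\sum_{n=1}^\infty \frac{|g(n)|}{n}<\infty$, then $|f|$ possesses a nonzero mean value, i.e. $\lim_{x\to\infty}\frac1x\sum_{n\le x}|f(n)|$ exists and is nonzero. Likewise, if $\sum_{n=1}^\infty \frac{|f(n)|}{n}<\infty$, then $|g|$ possesses a nonzero mean value.
   Context: $\mathbb{N}$ denotes the positive integers. The mean value of an arithmetic function $h$ is $\lim_{x\to\infty}\frac{1}{x}\sum_{n\le x}h(n)$, when it exists. *)

(* Defs.v *)
From HB Require Import structures.
From mathcomp Require Import all_boot all_order all_algebra.
From mathcomp Require Import all_classical all_reals all_analysis.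
From mathcomp Require Import complex.
Set Implicit Arguments.
Unset Strict Implicit.
Unset Printing Implicit Defensive.
Import Order.TTheory GRing.Theory Num.Theory.
Import numFieldNormedType.Exports.
Local Open Scope classical_set_scope.
Local Open Scope ring_scope.

(* An arithmetic function is represented by a function on [nat] whose value at
   0 is irrelevant: every use below is restricted to positive arguments. *)

(* [normc] is the complex modulus with values in [R]; the norm [`|z|] of
   [z : R[i]] is the same number embedded in [R[i]]. *)
Definition modf (R : realType) (h : nat -> R[i]) : nat -> R :=
  fun n => ComplexField.Normc.normc (h n).

(* For [0 <= x], [Num.truncn x] is the integer part of [x]. *)
Definition has_mean_value (R : realType) (h : nat -> R) (m : R) : Prop :=
  x^-1 * (\sum_(1 <= n < (Num.truncn x).+1) h n) @[x --> +oo] --> m.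

Definition has_nonzero_mean_value (R : realType) (h : nat -> R) : Prop :=
  exists m : R, has_mean_value h m /\ m != 0.

Definition summable_over_n (R : realType) (h : nat -> R[i]) : Prop :=
  (\sum_(1 <= n <oo) (modf h n / n%:R)%:E < +oo)%E.

(* Main.v *)
Require Import Defs.
From HB Require Import structures.
From mathcomp Require Import all_boot all_order all_algebra.
From mathcomp Require Import all_classical all_reals all_analysis.
From mathcomp Require Import complex.
From mathcomp Require Import zify ring lra.
Set Implicit Arguments.
Unset Strict Implicit.
Unset Printing Implicit Defensive.
Import Order.TTheory GRing.Theory Num.Theory.
Import numFieldNormedType.Exports.
Local Open Scope classical_set_scope.
Local Open Scope ring_scope.

(* By Moebius inversion both halves concern h(n) = sum_(d | n) c(n/d) g(d) with
   sum |g(d)|/d finite and c = 1 or c = mu.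

   Truncating the sum at d <= T changes |h(n)| by at most sum_(d | n, d > T) |g(d)|.
   If no square k^2 with k > M divides n, where M >= T, then for Q = M!^3 the
   truncated sum at n is, up to sign, the truncated sum at gcd(n, Q). The
   remaining n contribute at most a constant times sum_(k^2 | n, k > M) 1. So
   |h(n)| is a periodic function of n up to an error bounded by sum_(d | n) G(d),
   where G >= 0 and sum G(d)/d is as small as we please; such an error has small
   mean, and |h| has a mean value by the Cauchy criterion.

   Let h(m) <> 0. Once m | Q, the periodic function is |h(m)| on the progression
   n = m mod Q. If such an n is divisible by d, then gcd(d, Q) divides m, so that
   at most N m/(d Q) + 1 such n are <= N. The error therefore averages to at most
   m sum G(d)/d over the progression, a bound that does not involve Q, and the
   mean value of |h| is at least a positive multiple of |h(m)|/Q. *)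

Local Open Scope nat_scope.

(** * Moebius function, its inversion formula and its periodicity up to sign *)

Definition moebius (n : nat) : int :=
  (\prod_(p <- primes n) (if logn p n == 1%N then -1 else 0))%R.

Lemma moebius_norm_le1 n : (`|moebius n| <= 1)%R.
Proof.
rewrite /moebius; elim/big_rec: _ => [|p x _ x1]; first by rewrite normr1.
by rewrite normrM mulr_ile1 //; case: ifP.
Qed.

Lemma moebius_prime p : prime p -> moebius p = (-1)%R.
Proof.
by move=> pp; rewrite /moebius primes_prime // big_seq1 logn_prime ?eqxx.
Qed.

Lemma moebius_eq0 p n : 1 < logn p n -> moebius n = 0%R.
Proof.
move=> p2; rewrite /moebius (bigD1_seq p) ?primes_uniq //=; last first.
  by rewrite -logn_gt0 ltnW.
by rewrite gtn_eqF ?mul0r.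
Qed.

Lemma moebius_norm1 n : (forall p, logn p n <= 1) -> `|moebius n|%R = 1%R.
Proof.
move=> n1; rewrite /moebius big_seq; elim/big_rec: _ => [|p x pn x1].
  by rewrite normr1.
rewrite -logn_gt0 in pn.
by rewrite normrM x1 eqn_leq n1 pn.
Qed.

Lemma moebiusM m n : 0 < m -> 0 < n -> coprime m n ->
  moebius (m * n) = (moebius m * moebius n)%R.
Proof.
move=> m0 n0 cmn.
have Emn : perm_eq (primes (m * n)) (primes m ++ primes n).
  apply: uniq_perm; rewrite ?primes_uniq //; last first.
    by move=> p; rewrite mem_cat primesM.
  by rewrite cat_uniq !primes_uniq andbT /= -coprime_has_primes.
have Eprod (a b : nat) : coprime a b -> 0 < a -> 0 < b ->
  (\prod_(p <- primes a) (if logn p (a * b) == 1%N then -1 else 0) =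
  moebius a)%R.
  move=> cab a0 b0; apply: eq_big_seq => p; rewrite mem_primes => /and3P[pp _ pa].
  by rewrite lognM // (logn_coprime (coprime_dvdl pa cab)) addn0.
rewrite [LHS]/moebius (perm_big _ Emn) big_cat /= Eprod //; congr (_ * _)%R.
by rewrite mulnC Eprod // coprime_sym.
Qed.

(** For the least prime factor [p] of [n], the multiples of [p ^ 2] contribute 0, and [e |-> p * e]
    maps the divisors prime to [p] onto those divisible by [p] exactly once, reversing the sign of
    [moebius]. *)
Lemma sum_moebius n : 1 < n -> (\sum_(d <- divisors n) moebius d = 0)%R.
Proof.
move=> n1; have n0 : 0 < n by apply: ltnW.
set p := pdiv n; have pp : prime p by rewrite pdiv_prime.
have pn : p %| n by rewrite pdiv_dvd.
rewrite (bigID (fun d => p %| d)) /=.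
rewrite (bigID (fun d => p ^ 2 %| d)) /= big1_seq ?add0r; last first.
  move=> d /andP[/andP[_ p2]]; rewrite -dvdn_divisors // => dn.
  by apply: (@moebius_eq0 p); rewrite -pfactor_dvdn // (dvdn_gt0 n0).
have E : perm_eq [seq d <- divisors n | (p %| d) && ~~ (p ^ 2 %| d)]
    [seq p * e | e <- divisors n & ~~ (p %| e)].
  apply: uniq_perm.
  - by rewrite filter_uniq ?divisors_uniq.
  - rewrite map_inj_uniq ?filter_uniq ?divisors_uniq //.
    by move=> a b /eqP; rewrite eqn_pmul2l ?prime_gt0 // => /eqP.
  - move=> d; rewrite mem_filter -dvdn_divisors //; apply/idP/mapP.
      move=> /andP[/andP[/dvdnP[e ->] p2] dn]; exists e; last by rewrite mulnC.
      rewrite mem_filter -dvdn_divisors // (dvdn_trans (dvdn_mulr _ _) dn) // andbT.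
      by apply: contra p2 => pe; rewrite mulnC expnS expn1 dvdn_mul.
    move=> [e]; rewrite mem_filter -dvdn_divisors // => /andP[pe en] ->.
    rewrite dvdn_mulr //= expnS expn1 dvdn_pmul2l ?prime_gt0 // pe /=.
    by rewrite Gauss_dvd ?pn // prime_coprime.
rewrite -big_filter (perm_big _ E) big_map big_filter -big_split /=.
rewrite big1_seq // => e /andP[pe]; rewrite -dvdn_divisors // => en.
rewrite moebiusM ?(prime_gt0 pp) ?(dvdn_gt0 n0 en) ?prime_coprime //.
by rewrite moebius_prime // mulN1r addNr.
Qed.

(** The map [d |-> n %/ d] is a bijection from the divisors of [n] that are multiples of [e] onto
    the divisors of [n %/ e]. *)
Lemma sum_divisors_codivisors (V : nmodType) (F : nat -> V) e n :
  0 < n -> e %| n ->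
  (\sum_(d <- divisors n | (e %| d)%N) F (n %/ d)%N =
   \sum_(d <- divisors (n %/ e)%N) F d)%R.
Proof.
move=> n0 en; have e0 : 0 < e by apply: dvdn_gt0 en.
have ne0 : 0 < n %/ e by rewrite divn_gt0 // dvdn_leq.
rewrite -big_filter -(big_map (fun d => n %/ d) xpredT F).
apply: perm_big; apply: uniq_perm; rewrite ?divisors_uniq //.
  rewrite map_inj_in_uniq ?filter_uniq ?divisors_uniq // => a b.
  rewrite !mem_filter -!dvdn_divisors // => /andP[_ an] /andP[_ bn] ab.
  apply/eqP; rewrite -(@eqn_pmul2l (n %/ a)) ?divnK //; last first.
    by rewrite divn_gt0 ?(dvdn_gt0 n0) // dvdn_leq.
  by rewrite ab divnK.
move=> d; rewrite -dvdn_divisors //; apply/mapP/idP.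
  move=> [a]; rewrite mem_filter -dvdn_divisors // => /andP[ea an] ->.
  by rewrite dvdn_divRL // -[X in _ %| X](divnK an) dvdn_mul.
move=> dne; have dn : d %| n by apply: dvdn_trans dne (dvdn_div en).
have d0 : 0 < d by apply: dvdn_gt0 dn.
exists (n %/ d); last first.
  by rewrite -{1}(divnK dn) mulKn // divn_gt0 // dvdn_leq.
rewrite mem_filter -dvdn_divisors // dvdn_div // andbT dvdn_divRL //.
by rewrite mulnC -dvdn_divRL.
Qed.

(** Once [f] is expanded and the sums are exchanged, the coefficient of [g e] is the sum of
    [moebius] over the divisors of [n %/ e], which vanishes unless [e = n]. *)
Lemma moebius_inversion (R : pzRingType) (f g : nat -> R) :
  (forall n, 0 < n -> f n = (\sum_(d <- divisors n) g d)%R) ->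
  forall n, 0 < n ->
    g n = (\sum_(d <- divisors n) (moebius (n %/ d)%N)%:~R * f d)%R.
Proof.
move=> fE n n0.
have codiv := @sum_divisors_codivisors R (fun m => (moebius m)%:~R%R).
transitivity (\sum_(e <- divisors n)
    (\sum_(d <- divisors n | (e %| d)%N) (moebius (n %/ d)%N)%:~R) * g e)%R.
  rewrite (bigD1_seq n) ?divisors_uniq ?divisors_id //=.
  rewrite codiv // divnn n0 big_seq1.
  rewrite /moebius big_nil mul1r big1_seq ?addr0 // => e /andP[en].
  rewrite -dvdn_divisors // => edn.
  rewrite codiv // -rmorph_sum /= sum_moebius ?mul0r //.
  by rewrite ltn_divRL // mul1n ltn_neqAle en dvdn_leq.
under eq_bigr do rewrite mulr_suml.
rewrite (exchange_big_dep xpredT) //=; apply: eq_big_seq => d.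
rewrite -dvdn_divisors // => dn; have d0 : 0 < d by apply: dvdn_gt0 dn.
rewrite fE // -mulr_sumr; congr (_ * _)%R.
rewrite -big_filter; apply: perm_big; apply: uniq_perm.
- by rewrite filter_uniq ?divisors_uniq.
- exact: divisors_uniq.
- move=> e; rewrite mem_filter -!dvdn_divisors //.
  by rewrite andbC; apply: andb_idl => ed; apply: dvdn_trans dn.
Qed.

(* For the Moebius function, [u] is the sign [moebius (n %/ gcdn n Q)] when that
   is nonzero. *)
Definition almost_periodic_kernel (c : nat -> int) : Prop :=
  (forall n, `|c n| <= 1)%R /\
  forall M, exists Q, [/\ 0 < Q, M`! %| Q &
    forall n, 0 < n -> (forall k, M < k -> ~~ (k ^ 2 %| n)) ->
    exists2 u : int, (`|u| = 1)%R &
      forall d, 0 < d <= M -> d %| n -> c (n %/ d) = (u * c (gcdn n Q %/ d)%N)%R].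

Lemma one_kernel : almost_periodic_kernel (fun=> 1%R).
Proof.
split=> [n|M]; first by rewrite normr1.
exists M`!; split; rewrite ?fact_gt0 // => n _ _; exists 1%R; first by rewrite normr1.
by move=> d _ _; rewrite mul1r.
Qed.

(** Let [c = n %/ gcdn n Q]. If [c] is coprime to M!, multiplicativity splits off [moebius c], which
    is a sign: a prime whose square divides [c] would exceed [M], against the hypothesis on squares.
    Otherwise both Moebius values vanish. *)
Lemma moebius_kernel : almost_periodic_kernel moebius.
Proof.
split=> [n|M]; first exact: moebius_norm_le1.
(* With the exponent 3, a prime [p <= M] of full exponent in [gcdn n Q] keeps exponent at least 2
   after division by any [d <= M]. *)
set Q := M`! ^ 3; have Q0 : 0 < Q by rewrite expn_gt0 fact_gt0.
have MQ : M`! %| Q by rewrite dvdn_exp.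
exists Q; split=> // n n0 nE; set a := gcdn n Q.
have a0 : 0 < a by rewrite gcdn_gt0 n0.
have an : a %| n := dvdn_gcdl n Q.
set c := n %/ a; have nE' : n = c * a by rewrite divnK.
have c0 : 0 < c by rewrite divn_gt0 // dvdn_leq.
have [cM|] := boolP (coprime c M`!); last first.
  (* Some p <= M has the same exponent in [a] as in [Q], which exceeds its
     exponent in any d <= M by at least 2: both Moebius values vanish. *)
  rewrite coprime_has_primes ?fact_gt0 // negbK => /hasP[p pM pc].
  have lM : 0 < logn p M`! by rewrite logn_gt0.
  have lc : 0 < logn p c by rewrite logn_gt0.
  exists 1%R; first by rewrite normr1.
  move=> d /andP[d0 dM] dn; rewrite mul1r.
  have dF : d %| M`! by rewrite dvdn_fact // d0.
  have ld : logn p d <= logn p M`! by rewrite dvdn_leq_log ?fact_gt0.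
  have lna : logn p n = logn p c + logn p a by rewrite -lognM // -nE'.
  have la : logn p a = 3 * logn p M`!.
    have := logn_gcd p n0 Q0; rewrite -/a lognX lna /minn.
    by case: ltnP => // _; lia.
  have da : d %| a by rewrite dvdn_gcd dn (dvdn_trans dF).
  have la2 : 1 < logn p (a %/ d) by rewrite logn_div // la; lia.
  rewrite !(@moebius_eq0 p) //; rewrite logn_div // lna.
  by rewrite logn_div // in la2; rewrite (leq_trans la2) // leq_sub2r // leq_addl.
exists (moebius c).
  apply: moebius_norm1 => p; rewrite leqNgt; apply/negP => p2.
  have pp : prime p by move: (ltnW p2); rewrite logn_gt0 mem_primes => /andP[].
  have p2c : p ^ 2 %| c by rewrite pfactor_dvdn.
  have [pM|pM] := leqP p M; last first.
    by have /negP[] := nE p pM; rewrite (dvdn_trans p2c) // nE' dvdn_mulr.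
  have pF : p %| M`! by rewrite dvdn_fact // prime_gt0.
  have : p %| gcdn c M`! by rewrite dvdn_gcd pF (dvdn_trans _ p2c) // dvdn_exp.
  by rewrite (eqP cM) dvdn1 => /eqP p1; rewrite p1 in pp.
move=> d /andP[d0 dM] dn.
have da : d %| a by rewrite dvdn_gcd dn (dvdn_trans _ MQ) // dvdn_fact // d0.
have ad0 : 0 < a %/ d by rewrite divn_gt0 // dvdn_leq.
rewrite {1}nE' -muln_divA // moebiusM //.
apply: (@coprime_dvdr _ Q); last by rewrite coprimeXr.
by rewrite (dvdn_trans (dvdn_div da)) // dvdn_gcdr.
Qed.

Local Open Scope ring_scope.

(** * Divisor sums, tails and counting estimates *)

(** The range of summation becomes independent of [n], so that sums over [n] and [d] can be
    exchanged. *)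
Lemma sum_divisors_nat (V : nmodType) (F : nat -> V) n N : (0 < n <= N)%N ->
  \sum_(d <- divisors n) F d = \sum_(1 <= d < N.+1 | (d %| n)%N) F d.
Proof.
move=> /andP[n0 nN]; rewrite -[RHS]big_filter; apply: perm_big.
apply: uniq_perm; rewrite ?divisors_uniq ?filter_uniq ?iota_uniq // => d.
rewrite mem_filter mem_index_iota -dvdn_divisors //.
apply/idP/andP => [dn|[]//]; split=> //.
by rewrite (dvdn_gt0 n0 dn) ltnS (leq_trans (dvdn_leq n0 dn)).
Qed.

Lemma sum_nat_le_tail (R : realType) (u : nat -> R) T N :
  (forall n, 0 <= u n) ->
  \sum_(1 <= d < N.+1) u d <=
  \sum_(1 <= d < T.+1) u d + \sum_(1 <= d < N.+1 | (T < d)%N) u d.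
Proof.
move=> u0; rewrite (bigID (fun d => T < d)%N) /= addrC lerD2r.
rewrite (big_nat_widen _ _ (maxn N T).+1) ?ltnS ?leq_maxl //.
rewrite [leRHS](big_nat_widen _ _ (maxn N T).+1) ?ltnS ?leq_maxr //.
rewrite [leLHS]big_mkcond [leRHS]big_mkcond /=.
apply: ler_sum => d _; have -> : (d < T.+1)%N = ~~ (T < d)%N by rewrite -leqNgt.
by case: (T < d)%N => //=; case: ifP.
Qed.

(** [T] is chosen so that its partial sum is within [e] of the supremum of all partial sums. *)
Lemma small_tail (R : realType) (u : nat -> R) (B e : R) :
  (forall n, 0 <= u n) -> (forall N, \sum_(1 <= d < N.+1) u d <= B) -> 0 < e ->
  exists T, forall N, \sum_(1 <= d < N.+1 | (T < d)%N) u d <= e.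
Proof.
move=> u0 uB e0; pose E := range (fun N => \sum_(1 <= d < N.+1) u d).
have supE : has_sup E.
  split; first by exists (\sum_(1 <= d < 1) u d), 0%N.
  by exists B => _ [N _ <-].
have [_ [T _ <-] ST] := sup_adherent e0 supE; exists T => N.
have [TN|NT] := leqP T N; last first.
  rewrite big_nat_cond big1 ?ltW // => d /andP[/andP[_ dN] Td].
  by move: (leq_trans Td dN); lia.
have : \sum_(1 <= d < N.+1) u d <= sup E by apply: sup_upper_bound => //; exists N.
rewrite (bigID (fun d => T < d)%N) /= addrC.
have -> : \sum_(1 <= d < N.+1 | ~~ (T < d)%N) u d = \sum_(1 <= d < T.+1) u d.
  by rewrite (big_nat_widen 1 T.+1 N.+1) //; apply: eq_bigl => d; rewrite -leqNgt.
move: ST; lra.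
Qed.

(** Telescoping, from [1/k^2 <= 1/(k-1) - 1/k]. *)
Lemma sum_inv_sqr_tail (R : realType) (M N : nat) : (0 < M)%N ->
  \sum_(1 <= k < N.+1 | (M < k)%N) (k%:R ^+ 2)^-1 <= (M%:R^-1 : R).
Proof.
(* With [maxn M N] the stronger bound is 0 as long as the sum is empty, so the induction on [N] can
   start at 0. *)
move=> M0; suff : \sum_(1 <= k < N.+1 | (M < k)%N) (k%:R ^+ 2)^-1 <=
    (M%:R^-1 - (maxn M N)%:R^-1 : R).
  by move=> /le_trans; apply; rewrite gerBl invr_ge0.
elim: N => [|N IH]; first by rewrite big_geq // maxn0 subrr.
rewrite big_mkcond big_nat_recr //= -big_mkcond /=.
case: (boolP (M < N.+1)%N) => [MN|NM]; last first.
  have -> : maxn M N.+1 = maxn M N by lia.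
  by rewrite addr0.
have -> : maxn M N.+1 = N.+1 by lia.
have N0 : 0 < N%:R :> R by rewrite ltr0n; lia.
move: IH; have -> : maxn M N = N by lia.
move=> IH; suff : (N.+1%:R ^+ 2)^-1 <= N%:R^-1 - N.+1%:R^-1 :> R.
  by move=> NE; apply: le_trans (lerD IH NE) _; rewrite addrA subrK.
rewrite -natr1; set x := N%:R in N0 *.
have x1 : 0 < x + 1 by lra.
have -> : x^-1 - (x + 1)^-1 = (x * (x + 1))^-1 by field; rewrite !gt_eqF.
rewrite lef_pV2 ?posrE ?mulr_gt0 ?exprn_gt0 // expr2 ler_pM2r //; lra.
Qed.

(** The map [n |-> n %/ D] is injective on [A], with values between 0 and [N %/ D]. *)
Lemma count_separated (A : pred nat) (D N : nat) : (0 < D)%N ->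
  (forall a b, A a -> A b -> (a < b)%N -> (D <= b - a)%N) ->
  (count A (index_iota 1 N.+1) <= N %/ D + 1)%N.
Proof.
move=> D0 sepA; rewrite -size_filter addn1 -(size_map (fun n => n %/ D)%N).
rewrite -[X in (_ <= X)%N](size_iota 0); apply: uniq_leq_size.
  rewrite map_inj_in_uniq ?filter_uniq ?iota_uniq // => a b.
  rewrite !mem_filter => /andP[Aa _] /andP[Ab _] ab.
  wlog lt_ab : a b Aa Ab ab / (a < b)%N.
    by move=> wl; case: (ltngtP a b) => // lt; [|symmetry]; apply: wl.
  have := sepA a b Aa Ab lt_ab; rewrite leq_subRL ?(ltnW lt_ab) // => /(leq_div2r D).
  by rewrite divnDr ?dvdnn // divnn D0 -ab addn1 ltnn.
move=> _ /mapP[n nA ->]; move: nA.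
rewrite mem_filter mem_index_iota ltnS => /andP[_ /andP[_ nN]].
by rewrite mem_iota add0n ltnS leq_div2r.
Qed.

(** Two such [n] differ by a multiple of [lcmn d Q], which is [d * Q / gcdn d Q], and [gcdn d Q]
    divides [m] as soon as one such [n] exists. *)
Lemma count_progression_multiples (R : realType) (m Q d N : nat) :
  (0 < m)%N -> (0 < Q)%N -> (0 < d)%N ->
  \sum_(1 <= n < N.+1 | (n == m %[mod Q]) && (d %| n)%N) 1 <=
  (N%:R * m%:R / Q%:R) * d%:R^-1 + 1 :> R.
Proof.
move=> m0 Q0 d0; pose A n := (n == m %[mod Q]) && (d %| n)%N.
have -> : \sum_(1 <= n < N.+1 | A n) 1 = (count A (index_iota 1 N.+1))%:R :> R.
  by rewrite -sum1_count natr_sum.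
have [/hasP[n _ /andP[/eqP nm dn]]|] := boolP (has A (index_iota 1 N.+1)); last first.
  rewrite has_count -leqNgt leqn0 => /eqP ->.
  by rewrite addr_ge0 // !mulr_ge0 ?invr_ge0.
have lm : (gcdn d Q <= m)%N.
  rewrite dvdn_leq // (divn_eq m Q) dvdn_add //.
    by rewrite dvdn_mull ?dvdn_gcdr.
  rewrite -nm -(dvdn_addr _ (dvdn_mull (n %/ Q) (dvdn_gcdr d Q))) -divn_eq.
  exact: dvdn_trans (dvdn_gcdl d Q) dn.
have D0 : (0 < lcmn d Q)%N by rewrite lcmn_gt0 d0.
have sepA a b : A a -> A b -> (a < b)%N -> (lcmn d Q <= b - a)%N.
  move=> /andP[am da] /andP[bm db] ab; rewrite dvdn_leq ?subn_gt0 // dvdn_lcm.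
  by rewrite dvdn_sub //= -eqn_mod_dvd ?(ltnW ab) // (eqP am).
have := @count_separated A (lcmn d Q) N D0 sepA; rewrite -(ler_nat R) natrD => /le_trans; apply.
rewrite lerD2r ler_pdivlMr ?ltr0n // ler_pdivlMr ?ltr0n // -!natrM ler_nat.
rewrite -mulnA -(muln_lcm_gcd d Q) mulnA leq_mul //.
exact: leq_trunc_div.
Qed.

(** The sums are exchanged and the multiples of each [d] counted. The additive 1 in that count
    produces the last sum, which [sum_sublinear] makes negligible. *)
Lemma sum_progression_divisors (R : realType) (G : nat -> R) (m Q N : nat) :
  (0 < m)%N -> (0 < Q)%N -> (forall d, 0 <= G d) ->
  \sum_(1 <= n < N.+1 | n == m %[mod Q]) \sum_(d <- divisors n) G d <=
  (N%:R * m%:R / Q%:R) * (\sum_(1 <= d < N.+1) G d / d%:R) +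
  \sum_(1 <= d < N.+1) G d.
Proof.
move=> m0 Q0 G0.
have -> : \sum_(1 <= n < N.+1 | n == m %[mod Q]) \sum_(d <- divisors n) G d =
  \sum_(1 <= n < N.+1 | n == m %[mod Q]) \sum_(1 <= d < N.+1 | (d %| n)%N) G d.
  rewrite big_nat_cond [RHS]big_nat_cond; apply: eq_bigr => n /andP[nN _].
  exact: sum_divisors_nat.
rewrite (exchange_big_dep xpredT) //= mulr_sumr -big_split /=.
rewrite big_nat [leRHS]big_nat; apply: ler_sum => d /andP[d1 _].
under eq_bigr do rewrite -[G d]mulr1.
rewrite -mulr_sumr (le_trans (ler_wpM2l (G0 d) (count_progression_multiples _ _ m0 Q0 d1))) //.
by rewrite mulrDr mulr1 lerD2r mulrCA.
Qed.

(* Kronecker's lemma: the partial sums of [G] are o(N). *)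
Lemma sum_sublinear (R : realType) (G : nat -> R) (B e : R) :
  (forall d, 0 <= G d) -> (forall N, \sum_(1 <= d < N.+1) G d / d%:R <= B) ->
  0 < e -> exists N0, forall N, (N0 <= N)%N -> \sum_(1 <= d < N.+1) G d <= e * N%:R.
Proof.
move=> G0 GB e0; have e20 : 0 < e / 2 by rewrite divr_gt0.
have u0 d : 0 <= G d / d%:R by rewrite divr_ge0.
have [T tailT] := small_tail u0 GB e20.
set K := \sum_(1 <= d < T.+1) G d.
have K0 : 0 <= K by rewrite sumr_ge0.
exists (Num.bound (K / (e / 2))) => N NK.
have KN : K <= e / 2 * N%:R.
  rewrite mulrC -ler_pdivrMr // ltW // (lt_le_trans (archi_boundP _)) ?ler_nat //.
  by rewrite divr_ge0 // ltW.
apply: (le_trans (sum_nat_le_tail T N G0)).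
suff : \sum_(1 <= d < N.+1 | (T < d)%N) G d <= e / 2 * N%:R by rewrite -/K; lra.
(* For [d <= N], [G d] is at most [N] times [G d / d]. *)
rewrite (le_trans _ (ler_wpM2r (ler0n _ N) (tailT N))) // mulr_suml.
rewrite big_nat_cond [leRHS]big_nat_cond; apply: ler_sum => d /andP[/andP[d1 dN] _].
by rewrite mulrAC ler_pdivlMr ?ltr0n // ler_wpM2l // ler_nat.
Qed.

(** * Periodic functions and the Cauchy criterion for mean values *)

Lemma periodic_partial_sums (R : realType) (p : nat -> R) (Q : nat) : (0 < Q)%N ->
  (forall n, p (n + Q)%N = p n) ->
  exists K, forall N, `|\sum_(1 <= n < N.+1) p n -
    N%:R * ((\sum_(1 <= n < Q.+1) p n) / Q%:R)| <= K.
Proof.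
move=> Q0 pQ; set c := _ / _.
(* [D] is itself [Q]-periodic. *)
pose D N := \sum_(1 <= n < N.+1) p n - N%:R * c.
have DS N : D N.+1 = D N + (p N.+1 - c).
  by rewrite /D big_nat_recr //= -natr1; ring.
have DQ : D Q = D 0%N.
  rewrite /D [in RHS]big_geq // mul0r subr0 /c mulrCA divff ?mulr1 ?subrr //.
  by rewrite pnatr_eq0 -lt0n.
have Dper N : D (N + Q)%N = D N.
  elim: N => [|N IH]; first by rewrite add0n.
  by rewrite addSn !DS IH -addSn pQ.
have DperM k N : D (k * Q + N)%N = D N.
  by elim: k => [|k IH]; rewrite ?mul0n // mulSn -addnA addnC Dper.
exists (\sum_(i < Q) `|D i|) => N; rewrite -/(D N) (divn_eq N Q) DperM.
rewrite (bigD1 (Ordinal (ltn_pmod N Q0))) //= lerDl.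
exact: sumr_ge0.
Qed.

(** The constant [c] may vary with [e]: the averages are Cauchy, and completeness of [R] supplies
    the limit. *)
Lemma has_mean_value_approx (R : realType) (h : nat -> R) :
  (forall e, 0 < e -> exists c N0, forall N, (N0 <= N)%N ->
    `|\sum_(1 <= n < N.+1) h n - N%:R * c| <= e * N%:R) ->
  exists m, has_mean_value h m.
Proof.
move=> hyp; set F := fun x : R => x^-1 * (\sum_(1 <= n < (Num.truncn x).+1) h n).
suff /cvg_ex[m Fm] : cvg (F x @[x --> +oo]) by exists m.
apply/cauchy_cvgP/cauchy_exP => e e0.
have e20 : 0 < e / 2 by rewrite divr_gt0.
have [c [N0 cN0]] := hyp _ e20; exists c.
suff : \forall x \near +oo, ball c e (F x) by [].
near=> x.
have x0 : 0 < x by near: x; apply: nbhs_pinfty_gt; exact: num_real.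
have xc : 2 * `|c| / e < x by near: x; apply: nbhs_pinfty_gt; exact: num_real.
have xN : N0%:R <= x by near: x; apply: nbhs_pinfty_ge; exact: num_real.
have NN : (N0 <= Num.truncn x)%N by rewrite truncn_ge_nat // ltW.
have /andP[Nx xN1] := truncn_itv (ltW x0).
have := cN0 _ NN; rewrite /F; set N := Num.truncn x in Nx xN1 *; set S := \sum_(_ <= _ < _) _.
move=> SN; rewrite /ball /= -(ltr_pM2l x0) -[X in X * `|_|]gtr0_norm // -normrM.
rewrite mulrBr mulVKf ?gt_eqF // distrC.
(* Replacing the integer part [N] by [x] costs at most [|c|], which [xc] makes smaller than
   [e / 2 * x]. *)
have -> : S - x * c = (S - N%:R * c) - (x - N%:R) * c by ring.
rewrite (le_lt_trans (ler_normB _ _)) // normrM ger0_norm ?subr_ge0 //.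
have xNc : (x - N%:R) * `|c| <= `|c|.
  by rewrite -[leRHS]mul1r ler_wpM2r // lerBlDr addrC natr1 ltW.
move: xc; rewrite ltr_pdivrMr // => xc.
have : e / 2 * N%:R <= e / 2 * x by rewrite ler_pM2l.
by move: SN xNc xc; lra.
Unshelve. all: by end_near. Qed.

(** * Mean values of functions that are periodic up to small divisor sums *)

(** The periodic function is [n |-> P (gcdn n Q)]. The conditions on [m] give it the value [F m] on
    the whole progression [n = m] mod [Q], from which the lower bound of the mean is drawn. *)
Definition has_divisor_approx (R : realType) (F : nat -> R) : Prop :=
  forall m e, (0 < m)%N -> 0 < e -> exists Q (P G : nat -> R),
  [/\ (0 < Q)%N /\ (m %| Q)%N, P m = F m,
      forall d, 0 <= G d, forall N, \sum_(1 <= d < N.+1) G d / d%:R <= e &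
      forall n, (0 < n)%N -> `|F n - P (gcdn n Q)| <= \sum_(d <- divisors n) G d].

Lemma divisor_approx_mean (R : realType) (F : nat -> R) :
  has_divisor_approx F -> exists mu, has_mean_value F mu.
Proof.
move=> apxF; apply: has_mean_value_approx => e e0.
(* A quarter of [e] goes to each of the two sums in [sum_progression_divisors], the remaining half
   to [K]. *)
have e40 : 0 < e / 4 by rewrite divr_gt0.
have [Q [P [G [[Q0 _] _ G0 Ge FP]]]] := apxF 1%N _ isT e40.
have [N1 GN1] := sum_sublinear G0 Ge e40.
have perP n : P (gcdn (n + Q) Q) = P (gcdn n Q) by rewrite gcdnC gcdnDr gcdnC.
have [K PK] := @periodic_partial_sums R (fun n => P (gcdn n Q)) Q Q0 perP.
set c := _ / _ in PK; exists c, (maxn N1 (Num.bound (`|K| / (e / 2)))) => N.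
rewrite geq_max => /andP[NN1 NK].
have KN : K <= e / 2 * N%:R.
  rewrite (le_trans (ler_norm K)) // mulrC -ler_pdivrMr ?divr_gt0 //.
  rewrite ltW // (lt_le_trans (archi_boundP _)) ?ler_nat //.
  by rewrite divr_ge0 // ltW ?divr_gt0.
set SP := \sum_(1 <= n < N.+1) P (gcdn n Q).
have FPN : `|\sum_(1 <= n < N.+1) F n - SP| <= e / 2 * N%:R.
  rewrite -sumrB (le_trans (ler_norm_sum _ _ _)) //.
  apply: (@le_trans _ _ (\sum_(1 <= n < N.+1) \sum_(d <- divisors n) G d)).
    by apply: ler_sum_nat => n /andP[n0 _]; exact: FP.
  (* The progression modulo 1 consists of all [n]. *)
  have := @sum_progression_divisors R G 1 1 N isT isT G0.
  under eq_bigl do rewrite !modn1 eqxx.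
  move=> /le_trans; apply; rewrite !divr1 mulr1.
  have := ler_wpM2l (ler0n R N) (Ge N); have := GN1 N NN1; lra.
have -> : \sum_(1 <= n < N.+1) F n - N%:R * c =
  (\sum_(1 <= n < N.+1) F n - SP) + (SP - N%:R * c) by rewrite addrA subrK.
rewrite (le_trans (ler_normD _ _)) //; have := PK N; rewrite -/SP; lra.
Qed.

(** Only the progression [n = m] mod [Q] is kept, where [F n] is at least [F m] minus the divisor
    sum of [G] at [n]. *)
Lemma divisor_approx_lower (R : realType) (F : nat -> R) m :
  has_divisor_approx F -> (forall n, 0 <= F n) -> (0 < m)%N -> 0 < F m ->
  exists2 e, 0 < e & exists N0, forall N, (N0 <= N)%N ->
    e * N%:R <= \sum_(1 <= n < N.+1) F n.
Proof.
move=> apxF F0 m0 Fm0; have m0R : 0 < m%:R :> R by rewrite ltr0n.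
(* Multiplied by [N * m / Q], this bound gives a quarter of the main term [F m * N / Q]. The
   sublinear sum of [G] and [F m * K] cost at most a quarter each, and the last quarter is the lower
   bound obtained. *)
have e0 : 0 < F m / 4 / m%:R by rewrite !divr_gt0.
have [Q [P [G [[Q0 mQ] Pm G0 Ge FP]]]] := apxF m _ m0 e0.
have Q0R : 0 < Q%:R :> R by rewrite ltr0n.
have d0 : 0 < F m / 4 / Q%:R by rewrite !divr_gt0.
have [N1 GN1] := sum_sublinear G0 Ge d0.
pose p n : R := (n == m %[mod Q])%:R.
have perp n : p (n + Q)%N = p n by rewrite /p modnDr.
have [K pK] := periodic_partial_sums Q0 perp.
set c := _ / _ in pK.
have cQ : Q%:R^-1 <= c.
  rewrite /c -[leLHS]mul1r ler_wpM2r ?invr_ge0 //.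
  have mQ1 : m \in index_iota 1 Q.+1 by rewrite mem_index_iota m0 ltnS dvdn_leq.
  rewrite (bigD1_seq m mQ1) ?iota_uniq //=.
  by rewrite {1}/p eqxx lerDl sumr_ge0.
exists (F m / 4 / Q%:R) => //.
exists (maxn N1 (Num.bound (`|F m * K| / (F m / 4 / Q%:R)))) => N.
rewrite geq_max => /andP[NN1 NK].
have KN : F m * K <= F m / 4 / Q%:R * N%:R.
  rewrite (le_trans (ler_norm _)) // [leRHS]mulrC -ler_pdivrMr //.
  rewrite ltW // (lt_le_trans (archi_boundP _)) ?ler_nat //.
  by rewrite divr_ge0 // ltW.
rewrite (bigID (fun n => n == m %[mod Q])) /=.
rewrite -[leLHS]addr0 lerD ?sumr_ge0 //.
have Fge : \sum_(1 <= n < N.+1 | n == m %[mod Q])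
    (F m - \sum_(d <- divisors n) G d) <=
    \sum_(1 <= n < N.+1 | n == m %[mod Q]) F n.
  rewrite big_nat_cond [leRHS]big_nat_cond; apply: ler_sum => n.
  move=> /andP[/andP[n0 _] /eqP nm]; have := FP n n0.
  have -> : gcdn n Q = m by rewrite -gcdn_modl nm gcdn_modl; apply/gcdn_idPl.
  rewrite Pm ler_norml => /andP[]; lra.
apply: le_trans Fge; rewrite sumrB.
have -> : \sum_(1 <= n < N.+1 | n == m %[mod Q]) F m =
    F m * \sum_(1 <= n < N.+1) p n.
  rewrite mulr_sumr big_mkcond; apply: eq_bigr => n _; rewrite /p.
  by case: ifP; rewrite ?mulr1 ?mulr0.
have := @sum_progression_divisors R G m Q N m0 Q0 G0.
have := GN1 N NN1.
have : N%:R * m%:R / Q%:R * (\sum_(1 <= d < N.+1) G d / d%:R) <= F m / 4 / Q%:R * N%:R.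
  apply: le_trans (ler_wpM2l _ (Ge N)) _; first by rewrite !mulr_ge0 ?invr_ge0.
  rewrite le_eqVlt; apply/orP; left; apply/eqP.
  by field; rewrite !gt_eqF.
have : F m / Q%:R * N%:R <= F m * (\sum_(1 <= n < N.+1) p n + K).
  rewrite -mulrA ler_pM2l // mulrC.
  have := ler_wpM2l (ler0n R N) cQ; have := pK N; rewrite ler_norml => /andP[].
  lra.
rewrite mulrDr; set x := F m / Q%:R * N%:R.
have -> : F m / 4 / Q%:R * N%:R = x / 4 by rewrite /x; lra.
move: KN; have -> : F m / 4 / Q%:R * N%:R = x / 4 by rewrite /x; lra.
lra.
Qed.

Lemma divisor_approx_nonzero_mean (R : realType) (F : nat -> R) m :
  has_divisor_approx F -> (forall n, 0 <= F n) -> (0 < m)%N -> 0 < F m ->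
  has_nonzero_mean_value F.
Proof.
move=> apxF F0 m0 Fm0; have [mu muF] := divisor_approx_mean apxF.
exists mu; split => //; rewrite gt_eqF //.
have [e e0 [N0 eN]] := divisor_approx_lower apxF F0 m0 Fm0.
(* The factor 1/2 comes from [Num.truncn x >= x / 2] for [x >= 1]. *)
suff : e / 2 <= mu by apply: lt_le_trans; rewrite divr_gt0.
rewrite -(cvg_lim _ muF) //; apply: limr_ge; first by apply/cvg_ex; exists mu.
near=> x.
have x1 : 1 <= x by near: x; apply: nbhs_pinfty_ge; exact: num_real.
have x0 : 0 < x by apply: lt_le_trans x1.
have xN : N0%:R <= x by near: x; apply: nbhs_pinfty_ge; exact: num_real.
have NN : (N0 <= Num.truncn x)%N by rewrite truncn_ge_nat // ltW.
have /andP[Nx] := truncn_itv (ltW x0); rewrite -natr1 => xN1.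
have N1 : 1 <= (Num.truncn x)%:R :> R by rewrite ler1n truncn_gt0.
rewrite [leRHS]mulrC ler_pdivlMr //; apply: le_trans (eN _ NN).
rewrite -mulrA ler_pM2l //; lra.
Unshelve. all: by end_near. Qed.

(** * Complex modulus, and the weight carried by large squares *)

Local Notation normc := ComplexField.Normc.normc.

Lemma normc_sum (R : rcfType) (I : Type) (r : seq I) (P : pred I) (F : I -> R[i]) :
  normc (\sum_(i <- r | P i) F i) <=
  \sum_(i <- r | P i) normc (F i).
Proof.
elim/big_ind2: _ => [|x1 x2 y1 y2 h1 h2|i _ //]; first by rewrite ComplexField.Normc.normc0.
exact: le_trans (le_normcD _ _) (lerD h1 h2).
Qed.

Lemma normc_ge0 (R : rcfType) (x : R[i]) : 0 <= normc x.
Proof. by case: x => a b; exact: sqrtr_ge0. Qed.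

Lemma normc_intM (R : rcfType) (z : int) (x : R[i]) :
  normc (z%:~R * x) = `|z|%:~R * normc x.
Proof.
rewrite ComplexField.Normc.normcM; congr (_ * _).
case: z => n; rewrite ?NegzE ?rmorphN /= ?normcN ?normrN.
  by rewrite (@normcMn R 1 n) ComplexField.Normc.normc1.
by rewrite (@normcMn R 1 n.+1) ComplexField.Normc.normc1.
Qed.

Lemma normc_dist (R : rcfType) (x y : R[i]) :
  `|normc x - normc y| <=
  normc (x - y).
Proof.
have h (u v : R[i]) : normc u - normc v <=
    normc (u - v).
  by rewrite lerBlDr -{1}[u](subrK v); exact: le_normcD.
rewrite ler_norml h andbT lerNl opprB -[x - y]opprB normcN; exact: h.
Qed.

(** Bounding the indicator by a sum over [k] and exchanging sums leaves at most one term [1/k^2] for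
    each [k > M]. The restriction to [k <= d] loses nothing, since [k <= k ^ 2]. *)
Lemma sum_inv_squares (R : realType) (M N : nat) : (0 < M)%N ->
  \sum_(1 <= d < N.+1) [exists k : 'I_d.+1, (M < k) && (d == k ^ 2)]%N%:R / d%:R
  <= (M%:R^-1 : R).
Proof.
move=> M0; apply: le_trans (sum_inv_sqr_tail R N M0).
apply: (@le_trans _ _ (\sum_(1 <= d < N.+1) \sum_(1 <= k < N.+1 | (M < k)%N)
   (d == k ^ 2)%N%:R / d%:R)).
  rewrite big_nat [leRHS]big_nat; apply: ler_sum => d /andP[d0 dN].
  rewrite -mulr_suml ler_wpM2r ?invr_ge0 //.
  case: existsP => [[k /andP[Mk dk]]|_]; last first.
    by rewrite sumr_ge0.
  have kN : (k : nat) \in index_iota 1 N.+1.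
    by rewrite mem_index_iota; move: (ltn_ord k); lia.
  rewrite big_mkcond (bigD1_seq _ kN) ?iota_uniq //= Mk dk lerDl.
  by apply: sumr_ge0 => i _; case: ifP.
rewrite exchange_big /=; apply: ler_sum => k Mk.
have [kN|kN] := boolP ((k ^ 2)%N \in index_iota 1 N.+1).
  rewrite (bigD1_seq _ kN) ?iota_uniq //= eqxx mul1r natrX.
  by rewrite big1 ?addr0 // => d /negbTE ->; rewrite mul0r.
rewrite big1_seq ?invr_ge0 ?exprn_ge0 // => d /= dN.
by case: eqVneq => [dk|_]; [rewrite -dk dN in kN | rewrite mul0r].
Qed.

(** * Convolutions with an almost periodic kernel *)

(** [hT] is the sum truncated at [T]. [G1] pays for the truncation and [G2] for the [n] divisible by
    some [k ^ 2] with [k > M]; for all other [n], [hT n] and [hT (gcdn n Q)] have the same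
    modulus. *)
Lemma divisor_approx_convolution (R : realType) (c : nat -> int)
    (g h : nat -> R[i]) (B : R) :
  almost_periodic_kernel c ->
  (forall N, \sum_(1 <= d < N.+1) modf g d / d%:R <= B) ->
  (forall n, (0 < n)%N ->
     h n = \sum_(d <- divisors n) (c (n %/ d)%N)%:~R * g d) ->
  has_divisor_approx (modf h).
Proof.
move=> [c1 perc] gB hE m e m0 e0.
have g0 d : 0 <= modf g d by exact: normc_ge0.
have gd0 d : 0 <= modf g d / d%:R by rewrite divr_ge0.
have e20 : 0 < e / 2 by rewrite divr_gt0.
have [T1 tail1] := small_tail gd0 gB e20.
(* With [T >= m] the truncation does not affect the value at [m], whence [P m = F m]. *)
pose T := maxn T1 m.
have tailT N : \sum_(1 <= d < N.+1 | (T < d)%N) modf g d / d%:R <= e / 2.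
  apply: le_trans (tail1 N); rewrite big_mkcond [leRHS]big_mkcond.
  apply: ler_sum => d _; case: ifP => [|_]; last by case: ifP.
  by rewrite gtn_max => /andP[->].
pose K := \sum_(1 <= d < T.+1) modf g d.
have K0 : 0 <= K by rewrite sumr_ge0.
(* [M >= T] lets the kernel property reach every [d] kept in [hT]; the other bound makes
   [2 * K / M], which dominates the sums of [G2 d / d], at most [e / 2]. *)
pose M := (maxn T (Num.bound (2 * K / (e / 2)))).+1.
have KM : 2 * K / M%:R <= e / 2.
  rewrite ler_pdivrMr ?ltr0n // [leRHS]mulrC -ler_pdivrMr //.
  rewrite ltW // (lt_le_trans (archi_boundP _)) ?ler_nat //.
    by rewrite divr_ge0 ?mulr_ge0 // ltW.
  by rewrite leqW // leq_maxr.
have TM : (T <= M)%N by rewrite leqW // leq_maxl.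
have [Q [Q0 MQ percQ]] := perc M.
pose hT n := \sum_(d <- divisors n | (d <= T)%N) (c (n %/ d)%N)%:~R * g d.
have term_le n d : normc ((c (n %/ d)%N)%:~R * g d) <= modf g d.
  by rewrite normc_intM ler_piMl ?normc_ge0 // (ler_int R _ 1).
have hTK n : (0 < n)%N -> normc (hT n) <= K.
  move=> n0; apply: le_trans (normc_sum _ _ _) _.
  apply: (@le_trans _ _ (\sum_(d <- divisors n | (d <= T)%N) modf g d)).
    by apply: ler_sum => d _; exact: term_le.
  rewrite /K (big_nat_widen _ _ (maxn n T).+1) ?ltnS ?leq_maxr // big_mkcond /=.
  rewrite (@sum_divisors_nat _ _ _ (maxn n T)) ?n0 ?leq_maxl //.
  rewrite big_mkcond [leRHS]big_mkcond; apply: ler_sum => d _.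
  by rewrite ltnS; case: ifP => // _; case: ifP.
pose G1 d := if (T < d)%N then modf g d else 0.
pose G2 d := 2 * K * [exists k : 'I_d.+1, (M < k) && (d == k ^ 2)]%N%:R.
have G10 d : 0 <= G1 d by rewrite /G1; case: ifP.
have G20 d : 0 <= G2 d by rewrite /G2 !mulr_ge0.
exists Q, (fun a => normc (hT a)), (fun d => G1 d + G2 d); split.
- split=> //; apply: dvdn_trans MQ; rewrite dvdn_fact // m0.
  by rewrite (leq_trans _ TM) // leq_maxr.
- rewrite /modf hE // /hT -[in RHS]big_filter -[in LHS]big_filter.
  congr (normc _); congr (\big[_/_]_(_ <- _) _).
  apply: eq_in_filter => d; rewrite -dvdn_divisors // => dm.
  by rewrite (leq_trans (dvdn_leq m0 dm)) // leq_maxr.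
- by move=> d; rewrite addr_ge0.
- move=> N; under eq_bigr do rewrite mulrDl.
  rewrite big_split /= (splitr e) lerD //.
    apply: le_trans (tailT N); rewrite [leRHS]big_mkcond; apply: ler_sum => d _.
    by rewrite /G1; case: ifP; rewrite ?mul0r.
  apply: le_trans KM; rewrite /G2.
  under eq_bigr do rewrite -mulrA.
  by rewrite -mulr_sumr ler_wpM2l ?mulr_ge0 // sum_inv_squares.
move=> n n0; rewrite big_split /=.
set a := gcdn n Q; have a0 : (0 < a)%N by rewrite gcdn_gt0 n0.
have an : (a %| n)%N := dvdn_gcdl n Q.
rewrite (le_trans (ler_distD (normc (hT n)) _ _)) // lerD //.
  apply: le_trans (normc_dist _ _) _.
  rewrite hE // (bigID (fun d => d <= T)%N) /= addrC addrK.
  apply: le_trans (normc_sum _ _ _) _.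
  rewrite big_mkcond; apply: ler_sum => d _; rewrite -ltnNge /G1.
  by case: ifP.
(* A single divisor [k ^ 2] with [k > M] already contributes [2 * K] to the divisor sum of [G2], and
   this is the trivial bound for the difference. *)
have [[k [Mk kn]]|nosq] := pselect (exists k, (M < k)%N /\ (k ^ 2 %| n)%N).
  apply: (@le_trans _ _ (2 * K)).
    rewrite (le_trans (ler_normB _ _)) // !ger0_norm ?normc_ge0 //.
    by have := hTK n n0; have := hTK a a0; lra.
  rewrite dvdn_divisors // in kn.
  rewrite (bigD1_seq _ kn) ?divisors_uniq //= /G2.
  have -> : [exists j : 'I_(k ^ 2).+1, (M < j) && (k ^ 2 == j ^ 2)]%N.
    have kk : (k < (k ^ 2).+1)%N by rewrite ltnS -[leqLHS]expn1 leq_pexp2l //; lia.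
    by apply/existsP; exists (Ordinal kk); rewrite /= Mk eqxx.
  by rewrite mulr1 lerDl sumr_ge0 // => d _; exact: G20.
have [|u u1 uc] := percQ n n0.
  by move=> k Mk; apply/negP => kn; apply: nosq; exists k.
(* [n] and [a] have the same divisors up to [T], because every positive [d <= T] divides M! and
   hence [Q]. *)
have -> : hT n = u%:~R * hT a.
  rewrite /hT mulr_sumr -[LHS]big_filter -[RHS]big_filter.
  have -> : [seq d <- divisors n | (d <= T)%N] = [seq d <- divisors a | (d <= T)%N].
    apply: (@irr_sorted_eq _ ltn ltn_trans ltnn).
    - by rewrite sorted_filter ?sorted_divisors_ltn //; exact: ltn_trans.
    - by rewrite sorted_filter ?sorted_divisors_ltn //; exact: ltn_trans.
    move=> d; rewrite !mem_filter -!dvdn_divisors // dvdn_gcd.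
    case: leqP => //= dT; apply/idP/andP => [dn|[]//]; split=> //.
    by rewrite (dvdn_trans _ MQ) // dvdn_fact // (dvdn_gt0 n0 dn) (leq_trans dT).
  apply: eq_big_seq => d; rewrite mem_filter -dvdn_divisors // => /andP[dT da].
  rewrite mulrA -intrM -uc //; last exact: dvdn_trans an.
  by rewrite (dvdn_gt0 a0 da) (leq_trans dT).
by rewrite normc_intM u1 mul1r subrr normr0 sumr_ge0.
Qed.

(** * From summability to nonzero mean values *)

Lemma summable_over_n_bounded (R : realType) (h : nat -> R[i]) :
  summable_over_n h -> exists B, forall N, \sum_(1 <= d < N.+1) modf h d / d%:R <= B.
Proof.
rewrite /summable_over_n => hfin.
have h0 n : (0 <= (modf h n / n%:R)%:E)%E by rewrite lee_fin divr_ge0 ?normc_ge0.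
have le_lim N := @nneseries_lim_ge R _ xpredT 1 N.+1 (fun n _ _ => h0 n).
set S := limn _ in hfin le_lim.
have S0 : (0 <= S)%E by apply: le_trans (le_lim 0%N); rewrite big_geq.
exists (fine S) => N; rewrite -lee_fin fineK ?ge0_fin_numE // -sumEFin.
exact: le_lim.
Qed.

Lemma convolution_nonzero_mean (R : realType) (c : nat -> int) (g h : nat -> R[i]) m :
  almost_periodic_kernel c -> summable_over_n g ->
  (forall n, (0 < n)%N ->
     h n = \sum_(d <- divisors n) (c (n %/ d)%N)%:~R * g d) ->
  (0 < m)%N -> h m <> 0 -> has_nonzero_mean_value (modf h).
Proof.
move=> kc /summable_over_n_bounded[B gB] hE m0 hm.
apply: (@divisor_approx_nonzero_mean _ _ m) => //.
- exact: divisor_approx_convolution hE.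
- by move=> n; exact: normc_ge0.
- rewrite lt_neqAle normc_ge0 andbT eq_sym; apply/eqP.
  by move/ComplexField.Normc.eq0_normc.
Qed.

Theorem theorem1p2 (R : realType) (f g : nat -> R[i])
    (fg_neq0 : ~ ((forall n : nat, (0 < n)%N -> f n = 0) /\
                  (forall n : nat, (0 < n)%N -> g n = 0)))
    (fE : forall n : nat, (0 < n)%N -> f n = \sum_(d <- divisors n) g d) :
  (summable_over_n g -> has_nonzero_mean_value (modf f)) /\
  (summable_over_n f -> has_nonzero_mean_value (modf g)).
Proof.
have gE := moebius_inversion fE.
(* [f] and [g] vanish only together, by the divisor sum in one direction and Moebius inversion in
   the other, so each of them has a nonzero value at some positive [m]. *)
have f_or_g (h : nat -> R[i]) : ((forall n, (0 < n)%N -> h n = 0) ->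
    (forall n, (0 < n)%N -> f n = 0) /\ (forall n, (0 < n)%N -> g n = 0)) ->
    exists2 m, (0 < m)%N & h m <> 0.
  move=> h0; apply: contrapT => nh; apply/fg_neq0/h0 => n n0.
  by apply: contrapT => hn; apply: nh; exists n.
split=> [gS|fS].
  have [|m m0 fm] := f_or_g f.
    move=> f0; split=> // n n0; rewrite gE // big1_seq // => d /= dn.
    by rewrite f0 ?mulr0 // (dvdn_gt0 n0) // dvdn_divisors.
  apply: (convolution_nonzero_mean one_kernel gS _ m0 fm) => n n0.
  by rewrite fE //; apply: eq_bigr => d _; rewrite mul1r.
have [|m m0 gm] := f_or_g g.
  move=> g0; split=> // n n0; rewrite fE // big1_seq // => d /= dn.
  by rewrite g0 // (dvdn_gt0 n0) // dvdn_divisors.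
exact: (convolution_nonzero_mean moebius_kernel fS gE m0 gm).
Qed.
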